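(* Let $p \geq 3$ be a prime number. Then for every integer $m\geq 0$, \begin{align*} \nu_p(P_{2m}(p)) &= \nu_p\Big(\binom{2m}{m}\Big), \\ \nu_p(P_{2m+1}(p)) &= 1 + \nu_p(2m+1) + \nu_p\Big(\binom{2m}{m}\Big). \end{align*} Moreover, for every integer $n\geq0$, $$ \nu_p(P_n(p)) = \frac{2s_p(\lfloor n/2\rfloor) - s_p(n) + (n\bmod 2)\,p}{p-1}. $$
   Context: $P_n(x)$ denotes the $n$-th Legendre polynomial, $P_n(x) = \sum_{k=0}^{n} \binom{n}{k}\binom{n+k}{k}\left(\frac{x-1}{2}\right)^k$. For a nonzero rational $r$, $\nu_p(r)$ is its $p$-adic valuation (exponent of $p$ in $r$). $s_p(n)$ denotes the sum of the base-$p$ digits of the nonnegative integer $n$. *)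

(* Defs.v *)
From HB Require Import structures.
From mathcomp Require Import all_boot all_order all_algebra.
Set Implicit Arguments.
Unset Strict Implicit.
Unset Printing Implicit Defensive.
Import Order.TTheory GRing.Theory Num.Theory.
Local Open Scope ring_scope.

Definition legendre (n : nat) : {poly rat} :=
  \sum_(0 <= k < n.+1)
     ('C(n, k)%:R * 'C(n + k, k)%:R) *: (2^-1 *: ('X - 1)) ^+ k.

(* Meaningful for p prime and r != 0 only: padic_val p 0 = 0. *)
Definition padic_val (p : nat) (r : rat) : int :=
  (logn p `|numq r|%N)%:Z - (logn p `|denq r|%N)%:Z.

(* (n %/ p ^ i) %% p is the i-th base-p digit of n; for p >= 2 it vanishes as
   soon as i >= n, because n < p ^ n. *)
Definition digit_sum (p n : nat) : nat :=
  (\sum_(0 <= i < n.+1) (n %/ p ^ i) %% p)%N.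

(* Main.v *)
(* The Legendre differential equation, obtained from the recurrence on the
   coefficients of P_n in powers of (x - 1) / 2, gives the recurrence
     (k + 1) (k + 2) a_(k + 2) = - (n - k) (n + k + 1) a_k
   for the coefficients a_k of x^k. Hence P_n has the parity of n; with
   e = n mod 2 and m = floor(n / 2), descending from the leading coefficient
   gives a_e = (-1)^m n! / (4^m m!^2), and ascending from a_e shows that
   (e + 2 j)! a_(e + 2 j) is an integer multiple of a_e. Since (e + 2 j)! has
   valuation at most j < 2 j for j > 0, the lowest term a_e p^e dominates
   P_n(p), whose valuation is therefore e + v(n!) - 2 v(m!). *)

Require Import Defs.
From HB Require Import structures.
From mathcomp Require Import all_boot all_order all_algebra.
From mathcomp Require Import ring lra zify.
Import Order.TTheory GRing.Theory Num.Theory.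
Local Open Scope ring_scope.

(** * The Legendre differential equation and the coefficient recurrence *)

(** This is P_n(1 + 2t), that is, P_n in the variable t = (x - 1) / 2. *)
Definition shifted_legendre (n : nat) : {poly rat} :=
  \poly_(k < n.+1) ('C(n, k)%:R * 'C(n + k, k)%:R).

Lemma legendre_comp n :
  legendre n = shifted_legendre n \Po (2^-1 *: ('X - 1)).
Proof.
rewrite /legendre /shifted_legendre poly_def big_mkord linear_sum /=.
by apply: eq_bigr => k _; rewrite comp_polyZ comp_Xn_poly.
Qed.

Lemma coef_shifted_legendre n k :
  (shifted_legendre n)`_k = 'C(n, k)%:R * 'C(n + k, k)%:R.
Proof.
rewrite coef_poly ltnS; case: leqP => // lt_nk.
by rewrite bin_small // mul0r.
Qed.

Lemma coef_shifted_legendre_rec n k :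
  k.+1%:R ^+ 2 * (shifted_legendre n)`_k.+1
  = (n%:R - k%:R) * (n%:R + k%:R + 1) * (shifted_legendre n)`_k.
Proof.
rewrite !coef_shifted_legendre; case: (leqP k n) => [le_kn | lt_nk]; last first.
  by rewrite (bin_small lt_nk) (bin_small (leqW lt_nk)) ?mul0r ?mulr0.
have e1 : k.+1%:R * 'C(n, k.+1)%:R = (n%:R - k%:R) * 'C(n, k)%:R :> rat.
  by rewrite -natrB // -!natrM mul_bin_left.
have e2 : k.+1%:R * 'C(n + k.+1, k.+1)%:R
          = (n%:R + k%:R + 1) * 'C(n + k, k)%:R :> rat.
  by rewrite -natrD natr1 -!natrM addnS -mul_bin_diag.
rewrite expr2 mulrACA e1 e2; ring.
Qed.

(** At t^k the equation reads (k + 1)^2 b_(k+1) + k (k + 1) b_k = n (n + 1) b_k, which is the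
    recurrence because n (n + 1) - k (k + 1) = (n - k) (n + k + 1). *)
Lemma shifted_legendre_ode n (B := shifted_legendre n) :
  ('X + 'X^2) * B^`()^`() + (1 + 2 * 'X) * B^`() = (n%:R * (n%:R + 1))%:P * B.
Proof.
apply/polyP => k; have rk := coef_shifted_legendre_rec n k.
rewrite -/B in rk *; rewrite mulrDl [(1 + _) * _]mulrDl mul1r.
rewrite -(mulrA 2) [2 * _]mulr_natl 3!coefD coefMn coefCM coefXM coefXnM.
rewrite coefXM !coef_deriv; case: k => [|[|k]] /= in rk *; rewrite ?subn2 /=.
- lra.
- lra.
- lra.
Qed.

(** Substitute t = (x - 1) / 2: then t + t^2 = (x^2 - 1) / 4 and 1 + 2t = x, and each derivative in
    x brings a factor 1/2. *)
Lemma legendre_ode n (P := legendre n) :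
  ('X^2 - 1) * P^`()^`() + 2 * 'X * P^`() = (n%:R * (n%:R + 1))%:P * P.
Proof.
have := congr1 (comp_poly (2^-1 *: ('X - 1))) (shifted_legendre_ode n).
rewrite /P legendre_comp; set B := shifted_legendre n.
set t := 2^-1 *: ('X - 1).
have h2 : 2 * (2^-1)%:P = 1 :> {poly rat}.
  by rewrite -polyC_natr -polyCM divff.
have dt : t^`() = (2^-1)%:P.
  by rewrite derivZ derivB -polyC1 derivC derivX subr0 alg_polyC.
have tE : t = (2^-1)%:P * ('X - 1) by rewrite mul_polyC.
rewrite !deriv_comp dt derivM deriv_comp derivC mulr0 addr0 dt.
rewrite !rmorphD !rmorphM /= !rmorphD /= !rmorph1 !rmorphM /= rmorph_nat.
rewrite comp_polyX comp_polyC => <-.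
set U := B^`()^`() \Po t; set V := B^`() \Po t; rewrite tE.
apply/eqP; rewrite -subr_eq0; set h := (2^-1)%:P in h2 *.
(* With [h] opaque to [ring], the difference of the sides is an explicit multiple of 2h - 1, which
   vanishes. *)
rewrite (_ : _ - _ = (2 * h - 1) * (U * (h * ('X - 1)) + V)); last by ring.
by rewrite h2 subrr mul0r.
Qed.

Lemma coef_legendre_rec n k :
  k.+1%:R * k.+2%:R * (legendre n)`_k.+2
  = - ((n%:R - k%:R) * (n%:R + k%:R + 1) * (legendre n)`_k).
Proof.
set P := legendre n.
have := congr1 (fun q : {poly rat} => q`_k) (legendre_ode n).
rewrite -/P mulrBl mul1r -(mulrA 2) [2 * _]mulr_natl coefD coefB coefMn coefCM.
rewrite coefXnM coefXM !coef_deriv.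
case: k => [|[|k]] /=; rewrite ?subn2 /= => rk; lra.
Qed.

(** * Explicit coefficients of P_n *)

Lemma coef_legendre_gt n k : (n < k)%N -> (legendre n)`_k = 0.
Proof.
move=> lt_nk; rewrite coef_sum big_nat big1 // => i /andP[_ le_in].
rewrite coefZ exprZn coefZ -polyC1 nth_default ?mulr0 //.
by rewrite size_exp_XsubC; apply: leq_trans lt_nk.
Qed.

Lemma coef_legendre_lead n : 2 ^+ n * (legendre n)`_n = 'C(2 * n, n)%:R.
Proof.
rewrite coef_sum big_nat_recr //= big_nat big1 ?add0r => [|i /andP[_ lt_in]].
  rewrite coefZ exprZn coefZ -polyC1.
  have /monicP : ('X - 1%:P : {poly rat}) ^+ n \is monic.
    by rewrite monic_exp ?monicXsubC.
  rewrite lead_coefE size_exp_XsubC /= => ->.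
  rewrite binn mul1r mulr1 mulrC -mulrA -exprMn mulVf // expr1n mulr1.
  by rewrite addnn mul2n.
by rewrite coefZ exprZn coefZ -polyC1 nth_default ?mulr0 // size_exp_XsubC.
Qed.

Lemma coef_legendre_parity n k : odd (n + k) -> (legendre n)`_k = 0.
Proof.
move=> odd_nk; case: (ltnP n k) => [/coef_legendre_gt // | le_kn].
(* Here [i] counts the steps of two from k up to n + 1, where the coefficient vanishes. On the way
   down, (n - k) (n + k + 1) is never zero. *)
have [i] : exists i, (k + 2 * i = n.+1)%N by exists ((n.+1 - k)./2); lia.
elim: i k {odd_nk le_kn} => [|i IHi] k ki.
  by apply: coef_legendre_gt; lia.
have := coef_legendre_rec n k; rewrite (IHi k.+2) ?mulr0; last by lia.
move=> /esym/eqP; rewrite oppr_eq0 !mulf_eq0 => /orP[/orP[]|/eqP //].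
  by rewrite subr_eq0 eqr_nat; lia.
by rewrite -natrD natr1 pnatr_eq0.
Qed.

(** Since e + 2j = n - 2i and m + j + e = n - i, this is the classical formula a_(n-2i) = (-1)^i (2n
    - 2i)! / (2^n i! (n - i)! (n - 2i)!) without denominators. The induction on [i] descends from
    the leading coefficient. *)
Lemma coef_legendre_fact (e m i j : nat) (n := (e + 2 * m)%N) : (i + j = m)%N ->
  2 ^+ n * i`!%:R * (m + j + e)`!%:R * (e + 2 * j)`!%:R *
    (legendre n)`_(e + 2 * j)
  = (-1) ^+ i * (2 * (m + j + e))`!%:R.
Proof.
elim: i j => [|i IHi] j.
  rewrite add0n => ->; rewrite -/n fact0 mulr1 expr0 mul1r.
  have -> : (m + m + e = n)%N by rewrite /n; lia.
  have := @bin_fact (2 * n) n; rewrite (_ : 2 * n - n = n)%N; last by lia.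
  move=> <-; last by lia.
  by rewrite !natrM -coef_legendre_lead; ring.
move=> ij; have := IHi j.+1; have := coef_legendre_rec n (e + 2 * j).
have -> : (e + 2 * j.+1 = (e + 2 * j).+2)%N by lia.
have -> : (m + j.+1 + e = (m + j + e).+1)%N by lia.
set k := (e + 2 * j)%N; set s := (m + j + e)%N.
have -> : (2 * s.+1 = (2 * s).+2)%N by lia.
have nkE : n%:R - k%:R = 2 * i.+1%:R :> rat.
  by rewrite -natrB -?natrM; [congr _%:R|]; rewrite /n /k; lia.
have nksE : n%:R + k%:R + 1 = (2 * s).+1%:R :> rat.
  by rewrite -natrD natr1; congr _.+1%:R; rewrite /n /k /s; lia.
rewrite nkE nksE !factS !natrM exprS => rk /(_ ltac:(lia)) IH.
(* This factor turns (2s)! into (2s + 2)! and s! into (s + 1)!, and together with i + 1 it completes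
   the coefficient 2 (i + 1) (2s + 1) of the recurrence. *)
have nz : (s.+1%:R * 2 * (2 * s).+1%:R : rat) != 0.
  by rewrite !mulf_neq0 ?pnatr_eq0.
apply: (mulfI nz).
transitivity (- (2 ^+ n * i`!%:R * s.+1%:R * s`!%:R * k`!%:R) *
   (- (2 * i.+1%:R * (2 * s).+1%:R * (legendre n)`_k))); first by ring.
rewrite -rk.
transitivity (- (2 ^+ n * i`!%:R * (s.+1%:R * s`!%:R) *
   (k.+2%:R * (k.+1%:R * k`!%:R)) * (legendre n)`_k.+2)); first by ring.
rewrite IH (_ : (2 * s).+2%:R = 2 * s.+1%:R) -?natrM; first by ring.
by congr _%:R; lia.
Qed.

Lemma coef_legendre_low n (m := n./2) :
  2 ^+ (2 * m) * (m`! ^ 2)%:R * (legendre n)`_(odd n) = (-1) ^+ m * n`!%:R.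
Proof.
have := coef_legendre_fact (odd n) m m 0 (addn0 m).
have nE : (odd n + 2 * m = n)%N by rewrite mul2n odd_double_half.
rewrite muln0 addn0 nE !addn0; case: (odd n) nE => /= nE.
  have -> : (2 * (m + 1) = n.+1)%N by lia.
  rewrite addn1 (factS n) (factS m) [1`!]/= -{1}nE exprD expr1 => h.
  (* For odd n the formula at j = 0 contains (m + 1)! and (n + 1)!; the common surplus factor is 2
     (m + 1) = n + 1. *)
  have nz : (2 * m.+1%:R : rat) != 0 by rewrite mulf_neq0 ?pnatr_eq0.
  apply: (mulfI nz); move: h; rewrite natrX !natrM mulr1 => h.
  transitivity (2 * 2 ^+ (2 * m) * m`!%:R * (m.+1%:R * m`!%:R) *
    (legendre n)`_1); first by ring.
  by rewrite h (_ : n.+1%:R = 2 * m.+1%:R) -?natrM; [ring | congr _%:R; lia].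
by rewrite fact0 addn0 (_ : 2 * m = n)%N // natrX => <-; ring.
Qed.

Lemma coef_legendre_low_neq0 n : (legendre n)`_(odd n) != 0.
Proof.
have := coef_legendre_low n; apply: contra_eq_neq => ->.
by rewrite mulr0 eq_sym mulf_neq0 ?signr_eq0 // pnatr_eq0 -lt0n fact_gt0.
Qed.

(** By the recurrence, passing from k! a_k to (k + 2)! a_(k+2) multiplies by an integer. The start
    is exact because e! = 1. *)
Lemma coef_legendre_dvd n j (e := nat_of_bool (odd n)) :
  exists R : int, (e + 2 * j)`!%:R * (legendre n)`_(e + 2 * j)
                  = (legendre n)`_e * R%:~R.
Proof.
elim: j => [|j [R IHj]].
  by exists 1; rewrite muln0 addn0 mulrC /e; case: (odd n).
have -> : (e + 2 * j.+1 = (e + 2 * j).+2)%N by lia.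
set k := (e + 2 * j)%N in IHj *.
exists (- ((n%:Z - k%:Z) * (n%:Z + k%:Z + 1)) * R).
rewrite !factS !natrM.
transitivity (k`!%:R * (k.+1%:R * k.+2%:R * (legendre n)`_k.+2)); first by ring.
rewrite coef_legendre_rec.
transitivity (- ((n%:R - k%:R) * (n%:R + k%:R + 1)) *
              (k`!%:R * (legendre n)`_k)); first by ring.
by rewrite IHj; ring.
Qed.

(** * Legendre's formula for factorials and p-adic valuations of rationals *)

(** Sum over i the Euclidean divisions by p of the quotients of n by p^i: the remainders are the
    digits, and the quotients add up to the valuation of n!. *)
Lemma digit_sum_logn_fact p n : prime p ->
  (digit_sum p n + (p - 1) * logn p n`! = n)%N.
Proof.
move=> p_pr; have p_gt1 := prime_gt1 p_pr; rewrite logn_fact // /digit_sum.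
set L := (\sum_(1 <= k < n.+1) n %/ p ^ k)%N.
have sumE : (\sum_(0 <= i < n.+1) n %/ p ^ i = n + L)%N.
  by rewrite big_ltn // expn0 divn1.
(* The shift adds one term, the quotient of n by p^(n+1), which is 0. *)
have sumSE : (\sum_(0 <= i < n.+1) n %/ p ^ i.+1 = L)%N.
  rewrite -(big_add1 _ _ 0 n.+2 predT (fun i => n %/ p ^ i)%N) /=.
  by rewrite big_nat_recr //= divn_small ?addn0 // ltnW // ltn_expl.
suff : (digit_sum p n + p * L = n + L)%N by rewrite /digit_sum; nia.
rewrite -sumE -sumSE big_distrr -big_split /=.
apply: eq_bigr => i _; rewrite expnSr divnMA addnC mulnC; exact/esym/divn_eq.
Qed.

(** The fraction need not be reduced: cross-multiplying with the reduced form shows that common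
    factors cancel in the difference. *)
Lemma padic_val_ratio p (a b : int) : a != 0 -> b != 0 ->
  padic_val p (a%:~R / b%:~R) = (logn p `|a|)%:Z - (logn p `|b|)%:Z.
Proof.
move=> a0 b0; rewrite /padic_val; set r := _ / _.
have r0 : r != 0 by rewrite mulf_neq0 ?invr_eq0 ?intr_eq0.
have : numq r * b = a * denq r.
  apply/eqP; rewrite -(eqr_int rat) !rmorphM /= numqE /r mulrAC divfK //.
  by rewrite intr_eq0.
move=> /(congr1 (fun z => logn p `|z|%N)).
rewrite /= !abszM !lognM ?absz_gt0 ?numq_eq0 ?denq_neq0 //; lia.
Qed.

Lemma padic_valM p (x y : rat) : x != 0 -> y != 0 ->
  padic_val p (x * y) = padic_val p x + padic_val p y.
Proof.
move=> x0 y0; rewrite -{1}[x]divq_num_den -{1}[y]divq_num_den mulf_div.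
rewrite -!intrM padic_val_ratio ?mulf_neq0 ?numq_eq0 ?denq_neq0 // /padic_val.
rewrite !abszM !lognM ?absz_gt0 ?numq_eq0 ?denq_neq0 //; lia.
Qed.

Lemma padic_val_int p (a : int) : padic_val p a%:~R = (logn p `|a|)%:Z.
Proof. by rewrite /padic_val numq_int denq_int logn1 subr0. Qed.

Lemma padic_val_nat p n : padic_val p n%:R = (logn p n)%:Z.
Proof. by rewrite -[n%:R]/(n%:Z%:~R) padic_val_int. Qed.

(* [r] is zero or has positive [p]-adic valuation. *)
Definition padic_small (p : nat) (r : rat) : Prop :=
  exists a b : int, ~~ (p %| b)%Z /\ r * b%:~R = p%:R * a%:~R.

Lemma padic_small0 p : (1 < p)%N -> padic_small p 0.
Proof.
move=> p_gt1; exists 0, 1; split; last by rewrite mulr0 mul0r.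
by rewrite dvdzE dvdn1 gtn_eqF.
Qed.

Lemma padic_smallD p r s : prime p ->
  padic_small p r -> padic_small p s -> padic_small p (r + s).
Proof.
move=> p_pr [a [b [pb ra]]] [c [d [pd sc]]].
exists (a * d + c * b), (b * d); split.
  by move: pb pd; rewrite !dvdzE abszM Euclid_dvdM // negb_or => -> ->.
transitivity (r * b%:~R * d%:~R + s * d%:~R * b%:~R); first by ring.
by rewrite ra sc; ring.
Qed.

(** If r = p a / b with b prime to p, then 1 + r = (b + p a) / b has numerator and denominator both
    prime to p. *)
Lemma padic_val_1Dsmall p r : prime p -> padic_small p r ->
  1 + r != 0 /\ padic_val p (1 + r) = 0.
Proof.
move=> p_pr [a [b [pb ra]]].
have b0 : b != 0 by apply: contraNneq pb => ->; rewrite dvdz0.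
have pc : ~~ (p %| b + p%:Z * a)%Z by rewrite rpredDr ?dvdz_mulr.
have c0 : b + p%:Z * a != 0 by apply: contraNneq pc => ->; rewrite dvdz0.
have -> : 1 + r = (b + p%:Z * a)%:~R / b%:~R.
  rewrite rmorphD rmorphM /= -ra mulrDl divff ?intr_eq0 // mulfK ?intr_eq0 //.
split; first by rewrite mulf_neq0 ?invr_eq0 ?intr_eq0.
have logn0 z : ~~ (p %| z)%Z -> logn p `|z|%N = 0%N.
  by rewrite dvdzE lognE => /negbTE /= ->; rewrite !andbF.
by rewrite padic_val_ratio // !logn0.
Qed.

(** * The lowest term dominates P_n(p) *)

Lemma padic_small_coef_legendre p n i (e := nat_of_bool (odd n)) :
  prime p -> (3 <= p)%N -> i != e ->
  padic_small p ((legendre n)`_i * p%:R ^+ i / (p%:R ^+ e * (legendre n)`_e)).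
Proof.
move=> p_pr p_ge3 i_e; have p_gt1 := prime_gt1 p_pr.
case: (boolP (odd (n + i))) => [/coef_legendre_parity -> | even_ni].
  by rewrite !mul0r; apply: padic_small0.
have [j iE j_gt0] : exists2 j, i = (e + 2 * j)%N & (0 < j)%N.
  by exists (i./2); move: i_e even_ni; rewrite /e; lia.
have [R] := coef_legendre_dvd n j; rewrite -/e -iE => aR.
have [d pd dE] := pfactor_coprime p_pr (fact_gt0 i).
set v := logn p i`! in dE.
(* Legendre's formula gives (p - 1) v <= i = e + 2j; as p - 1 >= 2 and e <= 1, this forces v <=
   j. *)
have le_vj : (v <= j)%N.
  have := digit_sum_logn_fact p i p_pr; rewrite -/v.
  by move: iE; rewrite /e; case: (odd n) => /=; nia.
have p0 : p%:R != 0 :> rat by rewrite pnatr_eq0; lia.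
have a0 : (legendre n)`_e != 0 := coef_legendre_low_neq0 n.
(* The ratio is p^(2j) R / i! with i! = d p^v, and v <= j < 2j leaves at least one factor p to split
   off. *)
exists (p%:Z ^+ (2 * j - v).-1 * R), d; split.
  by rewrite dvdzE /= -prime_coprime.
have pv0 : p%:R ^+ v != 0 :> rat by rewrite expf_neq0.
apply: (mulIf pv0); apply: (mulIf a0).
move: aR; rewrite dE natrM natrX => aR.
have piE : p%:R ^+ i =
    p%:R ^+ e * p%:R * p%:R ^+ (2 * j - v).-1 * p%:R ^+ v :> rat.
  by rewrite iE -exprSr -!exprD; congr (_ ^+ _); lia.
rewrite piE rmorphM rmorphXn /= -!pmulrn.
set A := (legendre n)`_e in a0 aR *; set B := (legendre n)`_i in aR *.
transitivity (p%:R * p%:R ^+ (2 * j - v).-1 * p%:R ^+ v *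
              (d%:R * p%:R ^+ v * B)).
  by field; rewrite a0 expf_neq0.
by rewrite aR; ring.
Qed.

Lemma legendre_at_prime p n (e := nat_of_bool (odd n)) :
  prime p -> (3 <= p)%N ->
  exists2 r, padic_small p r &
    (legendre n).[p%:R] = p%:R ^+ e * (legendre n)`_e * (1 + r).
Proof.
move=> p_pr p_ge3.
have le_en : (e < n.+1)%N by rewrite /e; lia.
(* All other terms, each divided by the lowest one. *)
exists (\sum_(i < n.+1 | i != Ordinal le_en)
          (legendre n)`_i * p%:R ^+ i / (p%:R ^+ e * (legendre n)`_e)).
  apply: (big_ind (padic_small p)) => [|r s|i i_e].
  - exact/padic_small0/prime_gt1.
  - exact: padic_smallD.
  - exact: padic_small_coef_legendre.
rewrite (@horner_coef_wide _ n.+1); last first.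
  by apply/leq_sizeP => i; apply: coef_legendre_gt.
rewrite (bigD1 (Ordinal le_en)) //= mulrDr mulr1 -mulr_suml [_ * (_ / _)]mulrC.
rewrite divfK ?[_ ^+ _ * _]mulrC // mulf_neq0 ?coef_legendre_low_neq0 //.
by rewrite expf_neq0 // pnatr_eq0 -lt0n prime_gt0.
Qed.

Lemma padic_val_legendre p n : prime p -> (3 <= p)%N ->
  (legendre n).[p%:R] != 0 /\
  padic_val p (legendre n).[p%:R]
  = (odd n)%:Z + (logn p n`!)%:Z - 2 * (logn p (n./2)`!)%:Z.
Proof.
move=> p_pr p_ge3; have p_gt0 := prime_gt0 p_pr.
have [r r_small ->] := legendre_at_prime p n p_pr p_ge3.
have [r0 vr] := padic_val_1Dsmall p r p_pr r_small.
have a0 := coef_legendre_low_neq0 n.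
have pe0 : p%:R ^+ odd n != 0 :> rat by rewrite expf_neq0 // pnatr_eq0 -lt0n.
have pa0 := mulf_neq0 pe0 a0.
split; first exact: mulf_neq0.
rewrite !padic_valM // vr addr0 -natrX padic_val_nat pfactorK //.
have fact_pow_gt0 : (0 < (n./2)`! ^ 2)%N by rewrite expn_gt0 fact_gt0.
have pow2_gt0 : (0 < 2 ^ (2 * n./2))%N by rewrite expn_gt0.
have := congr1 (padic_val p) (coef_legendre_low n).
have nat0 k : (0 < k)%N -> k%:R != 0 :> rat by rewrite pnatr_eq0 -lt0n.
rewrite -natrX -natrM !padic_valM ?signr_eq0 ?nat0 ?muln_gt0 ?pow2_gt0
  ?fact_gt0 //.
rewrite !padic_val_nat lognM // !lognX -signr_odd.
have -> : padic_val p ((-1) ^+ odd n./2) = 0.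
  by case: odd; rewrite /padic_val /= logn1.
(* The power of 4 in the lowest coefficient contributes nothing, since p is odd. *)
rewrite (_ : logn p 2 = 0%N); first by lia.
by rewrite logn_coprime // prime_coprime // gtnNdvd.
Qed.

Theorem theorem4 (p : nat) (p_prime : prime p) (p_ge3 : (3 <= p)%N) :
  (forall n : nat, (legendre n).[p%:R] != 0)
  /\ (forall m : nat,
        padic_val p (legendre (2 * m)).[p%:R] = padic_val p 'C(2 * m, m)%:R
        /\ padic_val p (legendre (2 * m + 1)).[p%:R]
           = 1 + padic_val p (2 * m + 1)%:R + padic_val p 'C(2 * m, m)%:R)
  /\ (forall n : nat,
        (padic_val p (legendre n).[p%:R])%:~R
        = (2 * (digit_sum p (n %/ 2))%:R - (digit_sum p n)%:R
             + (n %% 2)%:R * p%:R) / (p%:R - 1) :> rat).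
Proof.
have valE n := padic_val_legendre p n p_prime p_ge3.
split=> [n|]; first by case: (valE n).
split=> [m|n].
  have binE : logn p (2 * m)`! = (logn p 'C(2 * m, m) + 2 * logn p m`!)%N.
    have le_m : (m <= 2 * m)%N by lia.
    rewrite -(bin_fact le_m) (_ : 2 * m - m = m)%N; last by lia.
    by rewrite !lognM ?muln_gt0 ?fact_gt0 ?bin_gt0 //; lia.
  rewrite !padic_val_nat (valE (2 * m)%N).2 (valE (2 * m + 1)%N).2.
  have -> : (2 * m)./2 = m by lia.
  have -> : (2 * m + 1)./2 = m by lia.
  have -> : odd (2 * m) = false by lia.
  have -> : odd (2 * m + 1) = true by lia.
  (* In the odd case (2m + 1)! = (2m + 1) (2m)! yields the extra valuation of 2m + 1. *)
  by rewrite addn1 factS lognM ?fact_gt0 // binE; split; lia.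
have p1 : p%:R - 1 != 0 :> rat by rewrite subr_eq0 pnatr_eq1; lia.
apply: (mulIf p1); rewrite divfK // (valE n).2 divn2 modn2.
have natE k : k%:R = (digit_sum p k)%:R + (p%:R - 1) * (logn p k`!)%:R :> rat.
  by rewrite -{1}(digit_sum_logn_fact p k p_prime) natrD natrM natrB ?prime_gt0.
have nE : n%:R = (odd n)%:R + 2 * (n./2)%:R :> rat.
  by rewrite -natrM -natrD mul2n odd_double_half.
(* With m = floor(n / 2) and e = n mod 2, Legendre's formula turns (p - 1) (e + v(n!) - 2 v(m!))
   into (p - 1) e + (n - s(n)) - 2 (m - s(m)), and n - 2m = e raises the coefficient of e to p. *)
move: nE (natE n) (natE n./2); rewrite !(rmorphD, rmorphN, rmorphM) /= -!pmulrn.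
by lra.
Qed.
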